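(* $$2 \Big[ \sum_{n=1}^{\infty} \frac{1}{n^2} \Big]^2 = 5 \sum_{n=1}^{\infty} \frac{1}{n^4}.$$ *)

(* Defs.v *)
From Stdlib Require Export Reals.
From Coquelicot Require Export Coquelicot.

(* [Series] and [ex_series] index their terms from 0, so the series over
   n >= 1 with general term [a n] is the series of [fun k => a (S k)]. *)
Definition sum_from_1 (a : nat -> R) : R := Series (fun k => a (S k)).

Definition converges_from_1 (a : nat -> R) : Prop :=
  ex_series (fun k => a (S k)).

(* Main.v *)
Require Import Defs.
From Stdlib Require Import Reals.
From Coquelicot Require Import Coquelicot.
From Stdlib Require Import Lra Lia.
Open Scope R_scope.

(** The proof uses Zagier's weight
    f(x,y) = 1/(x y^3) + 1/(2 x^2 y^2) + 1/(x^3 y), which is symmetric, satisfies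
    f(x,y) - f(x+y,y) - f(x,x+y) = 1/(x^2 y^2) ([weight_split]), and has diagonal
    value f(n,n) = (5/2) / n^4.  Summing the identity over all pairs m, n >= 1
    should cancel every off-diagonal term, as the pairs (m+n,n) and (m,m+n) run
    over the pairs with first coordinate larger, resp. smaller; what remains is
    zeta(2)^2 = (5/2) zeta(4).

    The double series of f diverges, so the cancellation is performed on the
    square 1 <= m, n <= N.  The pairs (m+n,n) that leave the square, namely (p,n)
    with n <= N < p <= N+n, produce an error term [overflow]; the pairs (m,m+n)
    produce the same one by symmetry, and
    2 (sum 1/n^2)^2 = 5 (sum 1/n^4) - 4 [overflow] holds exactly for the partial
    sums ([finite_identity]).  For fixed n there are n such pairs, each of weight at
    most (5/2) / (N n^3), so the error is at most (5/2) (sum 1/n^2) / N, which tends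
    to 0 ([overflow_le]). *)

(** * Finite sums starting at 1 *)

Definition sum_to (a : nat -> R) (N : nat) : R := sum_n_m a 1 N.

Lemma sum_to_0 a : sum_to a 0 = 0.
Proof. apply (sum_n_m_zero a 1 0); lia. Qed.

Lemma sum_to_S a N : sum_to a (S N) = sum_to a N + a (S N).
Proof. apply (sum_n_Sm a 1 N); lia. Qed.

Lemma sum_n_shift a N : sum_n (fun k => a (S k)) N = sum_to a (S N).
Proof. apply (sum_n_m_S a 0 N). Qed.

Lemma sum_to_ext a b N :
  (forall n, (1 <= n <= N)%nat -> a n = b n) -> sum_to a N = sum_to b N.
Proof. apply sum_n_m_ext_loc. Qed.

Lemma sum_to_plus a b N :
  sum_to (fun n => a n + b n) N = sum_to a N + sum_to b N.
Proof. apply (sum_n_m_plus a b 1 N). Qed.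

Lemma sum_to_scal c a N : sum_to (fun n => c * a n) N = c * sum_to a N.
Proof. apply (sum_n_m_scal_l c a 1 N). Qed.

Lemma sum_to_le a b N :
  (forall n, (1 <= n <= N)%nat -> a n <= b n) -> sum_to a N <= sum_to b N.
Proof.
induction N as [|N IH]; intros H.
- rewrite !sum_to_0; lra.
- rewrite !sum_to_S; apply Rplus_le_compat; [apply IH; intros n Hn|]; apply H; lia.
Qed.

Lemma sum_to_const c N : sum_to (fun _ => c) N = INR N * c.
Proof.
induction N as [|N IH].
- rewrite sum_to_0; simpl; ring.
- rewrite sum_to_S, IH, S_INR; ring.
Qed.

Lemma sum_to_nonneg a N :
  (forall n, (1 <= n <= N)%nat -> 0 <= a n) -> 0 <= sum_to a N.
Proof.
intros H; replace 0 with (sum_to (fun _ => 0) N).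
- now apply sum_to_le.
- rewrite sum_to_const; ring.
Qed.

Lemma sum_to_shift (g : nat -> R) n :
  sum_to (fun j => g (S j)) n = sum_to g n + g (S n) - g 1%nat.
Proof.
induction n as [|n IH].
- rewrite !sum_to_0; ring.
- rewrite !sum_to_S, IH; ring.
Qed.

Lemma INR_pos n : (1 <= n)%nat -> 0 < INR n.
Proof. intros; apply lt_0_INR; lia. Qed.

(** * The weight and the exact identity for partial sums *)

Definition weight (x y : R) : R :=
  1 / (x * y ^ 3) + 1 / (2 * x ^ 2 * y ^ 2) + 1 / (x ^ 3 * y).

(** By the symmetry of the weight, [weight (x + y) x] stands for f(x,x+y). *)
Lemma weight_split x y : 0 < x -> 0 < y ->
  weight x y = weight (x + y) y + weight (x + y) x + 1 / x ^ 2 * (1 / y ^ 2).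
Proof. intros; unfold weight; field; repeat split; lra. Qed.

Lemma weight_diag x : 0 < x -> weight x x = 5 / 2 * (1 / x ^ 4).
Proof. intros; unfold weight; field; lra. Qed.

Lemma weight_nonneg x y : 0 < x -> 0 < y -> 0 <= weight x y.
Proof.
intros Hx Hy; unfold weight.
repeat apply Rplus_le_le_0_compat; apply Rlt_le, Rdiv_lt_0_compat; try lra;
  repeat apply Rmult_lt_0_compat; try apply pow_lt; lra.
Qed.

(** Writing t = y/x, the weight is (1 + t/2 + t^2) / (x y^3). *)
Lemma weight_le x y : 0 < y -> y <= x -> weight x y <= 5 / 2 * (1 / (x * y ^ 3)).
Proof.
intros Hy Hxy.
assert (Hx : 0 < x) by lra.
replace (weight x y)
  with ((1 + / 2 * (y / x) + (y / x) ^ 2) * (1 / (x * y ^ 3)))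
  by (unfold weight; field; lra).
assert (Ht : 0 <= y / x <= 1).
{ split.
  - apply Rlt_le, Rdiv_lt_0_compat; lra.
  - apply Rle_div_l; lra. }
apply Rmult_le_compat_r; [|nra].
apply Rlt_le, Rdiv_lt_0_compat; [lra|].
apply Rmult_lt_0_compat; [|apply pow_lt]; lra.
Qed.

(** Total weight of the pairs (p,n) with N < p <= N+n, written p = N+j. *)
Definition overflow_row (N n : nat) : R :=
  sum_to (fun j => weight (INR (N + j)) (INR n)) n.

Definition overflow (N : nat) : R := sum_to (overflow_row N) N.

Lemma overflow_row_S N n :
  overflow_row (S N) n =
  overflow_row N n + weight (INR (S N + n)) (INR n) - weight (INR (S N)) (INR n).
Proof.
unfold overflow_row.
rewrite (sum_to_ext _ (fun j => weight (INR (N + S j)) (INR n))).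
- rewrite (sum_to_shift (fun j => weight (INR (N + j)) (INR n))).
  now replace (N + S n)%nat with (S N + n)%nat by lia;
    replace (N + 1)%nat with (S N) by lia.
- intros j _; f_equal; f_equal; lia.
Qed.

Notation sum_inv2 := (sum_to (fun n => 1 / INR n ^ 2)).
Notation sum_inv4 := (sum_to (fun n => 1 / INR n ^ 4)).

(** Enlarging the square from side N to M = N + 1 adds the row n = M to the
    overflow and shifts each earlier row by one.  Pairing the nth term of the new
    row with the change of row n gives f(M+n,M) + f(M+n,n) - f(M,n), which
    [weight_split] evaluates; the last term f(2M,M) is left unpaired. *)
Lemma overflow_S N :
  overflow (S N) = overflow N + weight (INR (S N + S N)) (INR (S N))
                   - 1 / INR (S N) ^ 2 * sum_inv2 N.
Proof.
unfold overflow at 1.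
rewrite sum_to_S; unfold overflow_row at 2; rewrite sum_to_S.
enough (H : sum_to (overflow_row (S N)) N
            + sum_to (fun j => weight (INR (S N + j)) (INR (S N))) N
            + 1 / INR (S N) ^ 2 * sum_inv2 N = overflow N) by lra.
rewrite <- sum_to_scal, <- !sum_to_plus.
apply sum_to_ext; intros n Hn.
rewrite overflow_row_S.
rewrite (weight_split (INR (S N)) (INR n)) by (apply INR_pos; lia).
rewrite (plus_INR (S N) n); ring.
Qed.

Lemma finite_identity N :
  2 * sum_inv2 N ^ 2 = 5 * sum_inv4 N - 4 * overflow N.
Proof.
induction N as [|N IH].
- unfold overflow; rewrite !sum_to_0; ring.
- rewrite overflow_S, !sum_to_S, plus_INR.
  assert (HM : 0 < INR (S N)) by (apply INR_pos; lia).
  generalize (weight_split _ _ HM HM); rewrite (weight_diag _ HM); intros Hw.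
  assert (H4 : 1 / INR (S N) ^ 2 * (1 / INR (S N) ^ 2) = 1 / INR (S N) ^ 4)
    by (field; lra).
  rewrite H4 in Hw.
  nra.
Qed.

(** * Limits *)

(** The bound 1/n^2 <= 1/(n-1) - 1/n telescopes. *)
Lemma sum_inv2_bound N : sum_inv2 N <= 2.
Proof.
assert (H : forall k, sum_inv2 (S k) <= 2 - / INR (S k)).
{ induction k as [|k IH].
  - rewrite sum_to_S, sum_to_0; simpl; lra.
  - rewrite sum_to_S.
    assert (Hk : 0 < INR (S k)) by (apply INR_pos; lia).
    rewrite (S_INR (S k)); set (x := INR (S k)) in *.
    enough (0 <= / x - / (x + 1) - 1 / (x + 1) ^ 2) by lra.
    replace (/ x - / (x + 1) - 1 / (x + 1) ^ 2)
      with (/ (x * (x + 1) ^ 2)) by (field; lra).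
    apply Rlt_le, Rinv_0_lt_compat.
    apply Rmult_lt_0_compat; [|apply pow_lt]; lra. }
destruct N as [|N].
- rewrite sum_to_0; lra.
- assert (0 < / INR (S N)) by (apply Rinv_0_lt_compat, INR_pos; lia).
  specialize (H N); lra.
Qed.

Lemma overflow_nonneg N : 0 <= overflow N.
Proof.
apply sum_to_nonneg; intros n Hn; apply sum_to_nonneg; intros j Hj.
apply weight_nonneg; apply INR_pos; lia.
Qed.

Lemma overflow_row_le N n : (1 <= n <= N)%nat ->
  overflow_row N n <= 5 / 2 * / INR N * (1 / INR n ^ 2).
Proof.
intros Hn.
assert (H0 : 0 < INR n) by (apply INR_pos; lia).
assert (HN : INR n <= INR N) by (apply le_INR; lia).
replace (5 / 2 * / INR N * (1 / INR n ^ 2))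
  with (INR n * (5 / 2 * (1 / (INR N * INR n ^ 3)))) by (field; lra).
unfold overflow_row; rewrite <- sum_to_const.
apply sum_to_le; intros j Hj.
assert (Hp : INR N <= INR (N + j)) by (apply le_INR; lia).
eapply Rle_trans; [apply weight_le; lra|].
apply Rmult_le_compat_l; [lra|].
assert (0 < INR n ^ 3) by now apply pow_lt.
unfold Rdiv; rewrite !Rmult_1_l; apply Rinv_le_contravar; nra.
Qed.

Lemma overflow_le N : (1 <= N)%nat -> overflow N <= 5 * / INR N.
Proof.
intros HN.
assert (0 < / INR N) by now apply Rinv_0_lt_compat, INR_pos.
apply Rle_trans with (5 / 2 * / INR N * sum_inv2 N).
- rewrite <- sum_to_scal; apply sum_to_le; intros n Hn; now apply overflow_row_le.
- generalize (sum_inv2_bound N); nra.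
Qed.

Lemma overflow_lim : is_lim_seq (fun N => overflow (S N)) 0.
Proof.
apply is_lim_seq_le_le with (fun _ => 0) (fun N => 5 * / INR (S N)).
- intros N; split; [apply overflow_nonneg | apply overflow_le; lia].
- apply is_lim_seq_const.
- replace (Finite 0) with (Rbar_mult 5 0) by (simpl; f_equal; ring).
  apply is_lim_seq_scal_l.
  apply (is_lim_seq_incr_1 (fun N => / INR N)).
  apply (is_lim_seq_inv INR p_infty); [apply is_lim_seq_INR | easy].
Qed.

Lemma converges_inv2 : converges_from_1 (fun n => 1 / INR n ^ 2).
Proof.
destruct (ex_finite_lim_seq_incr (fun N => sum_inv2 (S N)) 2) as [l Hl].
- intros N; rewrite (sum_to_S _ (S N)).
  assert (0 < 1 / INR (S (S N)) ^ 2); [|lra].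
  apply Rdiv_lt_0_compat; [lra|]; apply pow_lt, INR_pos; lia.
- intros N; apply sum_inv2_bound.
- exists l; apply is_lim_seq_ext with (2 := Hl).
  intros N; symmetry; apply (sum_n_shift (fun n => 1 / INR n ^ 2)).
Qed.

Lemma converges_inv4 : converges_from_1 (fun n => 1 / INR n ^ 4).
Proof.
apply (@ex_series_le R_AbsRing R_CompleteNormedModule)
  with (2 := converges_inv2).
intros k; change norm with Rabs.
assert (Hk : 1 <= INR (S k)) by (apply (le_INR 1); lia).
assert (H2 : 1 <= INR (S k) ^ 2) by nra.
assert (H4 : INR (S k) ^ 4 = INR (S k) ^ 2 * INR (S k) ^ 2) by ring.
rewrite Rabs_pos_eq.
- unfold Rdiv; rewrite !Rmult_1_l; apply Rinv_le_contravar; nra.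
- apply Rlt_le, Rdiv_lt_0_compat; nra.
Qed.

Lemma sum_to_lim a : converges_from_1 a ->
  is_lim_seq (fun N => sum_to a (S N)) (sum_from_1 a).
Proof.
intros H; apply is_lim_seq_ext with (sum_n (fun k => a (S k))).
- apply sum_n_shift.
- now apply Series_correct.
Qed.

(* [Series] is a total operator, hence the two convergence conjuncts: they
   ensure that the sums in the identity are genuine. *)
Theorem mainTheorem2 :
  converges_from_1 (fun n => 1 / INR n ^ 2) /\
  converges_from_1 (fun n => 1 / INR n ^ 4) /\
  2 * (sum_from_1 (fun n => 1 / INR n ^ 2)) ^ 2
  = 5 * sum_from_1 (fun n => 1 / INR n ^ 4).
Proof.
split; [exact converges_inv2 | split; [exact converges_inv4|]].
assert (L2 := sum_to_lim _ converges_inv2).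
assert (L4 := sum_to_lim _ converges_inv4).
set (z2 := sum_from_1 _) in *; set (z4 := sum_from_1 (fun n => 1 / INR n ^ 4)) in *.
assert (HL : is_lim_seq (fun N => 2 * sum_inv2 (S N) ^ 2) (2 * z2 ^ 2)).
{ apply (is_lim_seq_scal_l _ 2 (z2 ^ 2)); simpl pow.
  apply is_lim_seq_mult'; [exact L2|].
  apply is_lim_seq_mult'; [exact L2 | apply is_lim_seq_const]. }
assert (HR : is_lim_seq (fun N => 2 * sum_inv2 (S N) ^ 2) (5 * z4 - 4 * 0)).
{ apply is_lim_seq_ext with (fun N => 5 * sum_inv4 (S N) - 4 * overflow (S N)).
  - intros N; symmetry; apply finite_identity.
  - apply is_lim_seq_minus'.
    + apply (is_lim_seq_scal_l _ 5 z4), L4.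
    + apply (is_lim_seq_scal_l _ 4 0), overflow_lim. }
apply is_lim_seq_unique in HL; apply is_lim_seq_unique in HR.
rewrite HL in HR; injection HR; lra.
Qed.
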